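(* For every $m\ge 1$, the global observability condition holds for the loss matrix $L$ and the feedback matrix $H$ of the SumLoss game with top-1 feedback on $m$ items. That is, for every pair of learner's actions $\sigma_i,\sigma_j$, $$\ell_i-\ell_j\in \bigoplus_{k\in[m!]}\mathrm{Col}(S_k^{\top}).$$
   Context: Items are numbered $1,\dots,m$. A permutation $\sigma$ maps ranks to items ($\sigma(i)=j$: item $j$ is at position $i$), and $\sigma^{-1}$ maps items to ranks. The learner's actions are the $m!$ permutations $\sigma_1,\dots,\sigma_{m!}$; the adversary's actions are the $2^m$ binary relevance vectors $R_1,\dots,R_{2^m}\in\{0,1\}^m$. $\mathrm{SumLoss}(\sigma,R)=\sum_{i=1}^m\sigma^{-1}(i)R(i)$. Loss matrix: $L\in\mathbb{R}^{m!\times 2^m}$, $L_{i,j}=\mathrm{SumLoss}(\sigma_i,R_j)$; $\ell_i\in\mathbb{R}^{2^m}$ is its $i$th row. Feedback matrix (top-1 feedback): $H\in\{0,1\}^{m!\times 2^m}$, $H_{i,j}=R_j(\sigma_i(1))$. Signal matrix of action $\sigma_i$: $S_i\in\{0,1\}^{2\times 2^m}$ with $(S_i)_{1,\ell}=\mathbb{1}(H_{i,\ell}=0)$ and $(S_i)_{2,\ell}=\mathbb{1}(H_{i,\ell}=1)$. $\mathrm{Col}$ denotes column space, and $\bigoplus_k \mathrm{Col}(S_k^\top)$ denotes the (not necessarily direct) sum, i.e. the linear span of the columns of all the matrices $S_k^\top$. *)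

(* Defs.v *)
From HB Require Import structures.
From mathcomp Require Import all_boot all_order all_fingroup all_algebra.
From mathcomp Require Import reals.

Set Implicit Arguments.
Unset Strict Implicit.
Unset Printing Implicit Defensive.

Import GRing.Theory.
Local Open Scope ring_scope.

Section PartialMonitoring.
Variable F : fieldType.

Definition colspace (n p : nat) (A : 'M[F]_(n, p)) : {vspace 'cV[F]_n} :=
  <<[seq col j A | j : 'I_p]>>%VS.

Variables N M : nat.

(* The two rows are indexed by the feedback symbols 0 and 1 (in this order). *)
Definition signal_mx (H : 'M[bool]_(N, M)) (i : 'I_N) : 'M[F]_(2, M) :=
  \matrix_(s < 2, l < M) (nat_of_bool (H i l) == s)%:R.

(* Rows of [L] are transposed so as to live in the same space as the columns
   of the matrices [(signal_mx H k)^T]. *)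
Definition loss_vec (L : 'M[F]_(N, M)) (i : 'I_N) : 'cV[F]_M := (row i L)^T.

Definition globally_observable (L : 'M[F]_(N, M)) (H : 'M[bool]_(N, M)) : Prop :=
  forall i j : 'I_N,
    loss_vec L i - loss_vec L j
      \in (\sum_(k < N) colspace (signal_mx H k)^T)%VS.

End PartialMonitoring.

Definition relevance (m : nat) := {ffun 'I_m -> bool}.

(* Items and ranks are both ['I_m]; a permutation sends ranks to items.
   The 0-based index [k] stands for rank [k.+1]. *)
Definition SumLoss (R : realType) (m : nat) (s : 'S_m) (r : relevance m) : R :=
  \sum_(i < m) ((s^-1)%g i).+1%:R * (r i)%:R.

(* [sigma] and [rel] are the chosen numberings of the learner's and the
   adversary's actions. *)
Definition sumloss_mx (R : realType) (m N M : nat)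
    (sigma : 'I_N -> 'S_m) (rel : 'I_M -> relevance m) : 'M[R]_(N, M) :=
  \matrix_(i < N, j < M) SumLoss R (sigma i) (rel j).

Definition top1_feedback_mx (m : nat) (m_gt0 : (0 < m)%N) (N M : nat)
    (sigma : 'I_N -> 'S_m) (rel : 'I_M -> relevance m) : 'M[bool]_(N, M) :=
  \matrix_(i < N, j < M) rel j (sigma i (Ordinal m_gt0)).

(* Main.v *)
(* By linearity it is enough that, for every item [a], the vector of
   relevances of [a] lies in the span: it is the second column of the
   transposed signal matrix of any permutation ranking [a] first, and each
   loss vector is a combination of these relevance vectors. *)
Require Import Defs.
From HB Require Import structures.
From mathcomp Require Import all_boot all_order all_fingroup all_algebra.
From mathcomp Require Import reals.
Import GRing.Theory.
Local Open Scope ring_scope.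

Lemma col_in_colspace (F : fieldType) (n p : nat) (A : 'M[F]_(n, p)) (j : 'I_p) :
  col j A \in colspace A.
Proof. by apply/memv_span/imageP; exists j. Qed.

Definition relevance_vec (F : fieldType) {m M : nat}
    (rel : 'I_M -> relevance m) (a : 'I_m) : 'cV[F]_M :=
  \col_l (rel l a)%:R.

(** In ['I_2], [ord_max] is the feedback symbol 1, and the indicator that a bit equals 1 is the bit
    itself. *)
Lemma col_signal_top1 (F : fieldType) (m : nat) (m_gt0 : (0 < m)%N) (N M : nat)
    (sigma : 'I_N -> 'S_m) (rel : 'I_M -> relevance m) (k : 'I_N) :
  col ord_max (signal_mx F (top1_feedback_mx m_gt0 sigma rel) k)^T
    = relevance_vec F rel (sigma k (Ordinal m_gt0)).
Proof. by apply/matrixP=> l z; rewrite !mxE; case: (rel l _). Qed.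

Lemma loss_vec_sumloss (R : realType) (m N M : nat)
    (sigma : 'I_N -> 'S_m) (rel : 'I_M -> relevance m) (i : 'I_N) :
  loss_vec (sumloss_mx R sigma rel) i
    = \sum_a (((sigma i)^-1)%g a).+1%:R *: relevance_vec R rel a.
Proof.
apply/matrixP=> l z; rewrite !mxE summxE.
by apply: eq_bigr => a _; rewrite !mxE.
Qed.

Theorem theorem1 (R : realType) (m : nat) (m_gt0 : (0 < m)%N)
    (sigma : 'I_(m`!)%N -> 'S_m) (sigma_bij : bijective sigma)
    (rel : 'I_(2 ^ m)%N -> relevance m) (rel_bij : bijective rel) :
  globally_observable (sumloss_mx R sigma rel) (top1_feedback_mx m_gt0 sigma rel).
Proof.
have relevance_obs a : relevance_vec R rel a \in
    (\sum_(k < m`!) colspace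
       (signal_mx R (top1_feedback_mx m_gt0 sigma rel) k)^T)%VS.
  have [tau _ tauK] := sigma_bij.
  (* The transposition of the top rank with [a] ranks [a] first; [tau], inverse to [sigma], gives
     its index. *)
  pose k := tau (tperm (Ordinal m_gt0) a).
  have <- : sigma k (Ordinal m_gt0) = a by rewrite tauK tpermL.
  rewrite -col_signal_top1.
  by apply: (subvP (sumv_sup k _ (subvv _))) (col_in_colspace _ _ _ _ _).
move=> i j; rewrite !loss_vec_sumloss.
(* Each loss vector lies in the span by itself, so no cancellation in the difference is needed. *)
by apply: rpredB; apply: rpred_sum => a _; apply: rpredZ.
Qed.
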